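(* Let $k\ge 3$. Consider the $k$-dimensional Poisson regression model with first-order interactions on the design region $\mathcal{X}=\bigcup_{1\le i<j\le k}\mathcal{X}_{ij}$, where $\mathcal{X}_{ij}=\{(x_1,\dots,x_k): x_i,x_j\ge 0,\ x_\ell=0 \text{ for } \ell\ne i,j\}$. Let $\beta_0=0$, $\beta_1=\dots=\beta_k=-1$, $\rho_{ij}=-\beta_{ij}\ge 0$ for $1\le i<j\le k$, let $t_{ij}=(\sqrt{1+8\rho_{ij}}-1)/(2\rho_{ij})$ if $\rho_{ij}>0$ and $t_{ij}=2$ if $\rho_{ij}=0$, and let $\mathbf{x}_{ij}\in\mathcal{X}_{ij}$ be the point with $x_i=x_j=t_{ij}$. Let $\mathbf{x}_0=(0,\dots,0)$ and $\mathbf{x}_i=2\mathbf{e}_i$ for $i=1,\dots,k$ (where $\mathbf{e}_i$ is the $i$-th unit vector). Then the design which assigns equal weights $1/(1+k+k(k-1)/2)$ to the $1+k+k(k-1)/2$ settings $\mathbf{x}_0$, $\mathbf{x}_1,\dots,\mathbf{x}_k$ and $\mathbf{x}_{ij}$, $1\le i<j\le k$, is locally $D$-optimal at $\boldsymbol{\beta}$ on $\mathcal{X}$.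
   Context: In the $k$-dimensional Poisson regression model with first-order interactions, an observation at $\mathbf{x}=(x_1,\dots,x_k)$ is Poisson distributed with mean $\lambda(\mathbf{x})=\exp(\mathbf{f}(\mathbf{x})^\top\boldsymbol{\beta})$, where $\mathbf{f}(\mathbf{x})=(1,x_1,\dots,x_k,(x_ix_j)_{1\le i<j\le k})^\top$, so $\mathbf{f}(\mathbf{x})^\top\boldsymbol{\beta}=\beta_0+\sum_j\beta_jx_j+\sum_{i<j}\beta_{ij}x_ix_j$. A design $\xi$ on $\mathcal{X}$ is a finite collection of distinct settings $\mathbf{x}_i\in\mathcal{X}$ with weights $w_i\ge0$ summing to $1$; its information matrix is $\mathbf{M}_{\boldsymbol{\beta}}(\xi)=\sum_i w_i\lambda(\mathbf{x}_i)\mathbf{f}(\mathbf{x}_i)\mathbf{f}(\mathbf{x}_i)^\top$. A design is locally $D$-optimal at $\boldsymbol{\beta}$ on $\mathcal{X}$ if it maximizes $\det\mathbf{M}_{\boldsymbol{\beta}}(\xi)$ over all designs on $\mathcal{X}$. *)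

(* Defs.v *)
From HB Require Import structures.
From mathcomp Require Import all_boot all_order all_algebra.
From mathcomp Require Import reals.
From mathcomp Require Import sequences exp.
Set Implicit Arguments. Unset Strict Implicit. Unset Printing Implicit Defensive.
Import Order.TTheory GRing.Theory Num.Theory.
Local Open Scope ring_scope.

Definition pairs (k : nat) := {p : 'I_k * 'I_k | (p.1 < p.2)%N}.

(* index set of the regression functions f(x) = (1, x_1..x_k, (x_i x_j)_{i<j}):
   None = intercept, Some (inl j) = x_j, Some (inr (i,j)) = x_i x_j *)
Definition fidx (k : nat) : finType := option ('I_k + pairs k)%type.

Section Model.
Variables (R : realType) (k : nat).

Definition feat (x : 'rV[R]_k) (a : fidx k) : R :=
  match a with
  | None => 1
  | Some (inl j) => x ord0 j
  | Some (inr p) => x ord0 (val p).1 * x ord0 (val p).2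
  end.

Definition lam (beta : fidx k -> R) (x : 'rV[R]_k) : R :=
  expR (\sum_(a : fidx k) feat x a * beta a).

Record design := Design { dsize : nat; dpts : 'I_dsize -> 'rV[R]_k; dw : 'I_dsize -> R }.
Arguments dpts : clear implicits.
Arguments dw : clear implicits.

Definition design_on (X : 'rV[R]_k -> Prop) (xi : design) : Prop :=
  injective (dpts xi) /\ (forall i, X (dpts xi i)) /\ (forall i, 0 <= dw xi i)
  /\ \sum_i dw xi i = 1.

Definition infmat (beta : fidx k -> R) (xi : design) : 'M[R]_#|fidx k| :=
  \matrix_(a, b) \sum_i dw xi i * lam beta (dpts xi i)
      * feat (dpts xi i) (enum_val a) * feat (dpts xi i) (enum_val b).

Definition locally_D_optimal (beta : fidx k -> R) (X : 'rV[R]_k -> Prop)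
  (xi : design) : Prop :=
  design_on X xi /\
  forall xi', design_on X xi' -> \det (infmat beta xi') <= \det (infmat beta xi).

Definition region (x : 'rV[R]_k) : Prop :=
  exists i j : 'I_k, (i < j)%N /\ 0 <= x ord0 i /\ 0 <= x ord0 j /\
    forall l : 'I_k, l != i -> l != j -> x ord0 l = 0.

Definition beta_of (rho : pairs k -> R) (a : fidx k) : R :=
  match a with
  | None => 0
  | Some (inl _) => -1
  | Some (inr p) => - rho p
  end.

Definition tval (r : R) : R :=
  if 0 < r then (Num.sqrt (1 + 8 * r) - 1) / (2 * r) else 2.

Definition supp (rho : pairs k -> R) (a : fidx k) : 'rV[R]_k :=
  match a with
  | None => 0
  | Some (inl i) => \row_l (if l == i then 2 else 0)
  | Some (inr p) => \row_l (if (l == (val p).1) || (l == (val p).2)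
                            then tval (rho p) else 0)
  end.

Definition equal_design (rho : pairs k -> R) : design :=
  @Design #|fidx k| (fun i => supp rho (enum_val i))
    (fun _ => (1 + k + (k * (k - 1)) %/ 2)%:R^-1).

End Model.

(* Main.v *)
Require Import Defs.
From HB Require Import structures.
From mathcomp Require Import all_boot all_order all_algebra.
From mathcomp Require Import ring lra.
From mathcomp Require Import boolp classical_sets reals topology normedtype.
From mathcomp Require Import sequences derive exp.
Import Order.TTheory GRing.Theory Num.Theory.
Import numFieldNormedType.Exports.
Local Open Scope ring_scope.
Set Implicit Arguments. Unset Strict Implicit. Unset Printing Implicit Defensive.

(* The design is saturated, so on the region f(x) is interpolated from the
   support points, f(x) = sum_b L_b(x) f(x_b), and every information matrix is
   F^T N F with N a weighted sum of the L(x) L(x)^T.  Hadamard's inequality and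
   AM-GM bound det N as soon as lambda(x) sum_b L_b(x)^2 / lambda(x_b) <= 1.
   On the quadrant X_ij, along a level line of lambda, this sum is a convex
   quadratic function of x_i x_j, so only the axes and the diagonal matter; both
   cases reduce to the inequality e^s >= e s + (1 - s)^2 for s >= 0. *)

(** * Inequalities for the exponential function *)

Lemma is_derive_homo (R : realType) (f df : R -> R) (a b : R) :
  (forall x, is_derive (x : R) 1 f (df x)) -> a <= b ->
  (forall x, a <= x <= b -> 0 <= df x) -> f a <= f b.
Proof.
move=> fdf ab df0.
have cf : {within `[a, b], continuous f}%classic.
  apply: continuous_subspaceT => x.
  by apply/differentiable_continuous/derivable1_diffP; case: (fdf x).
have [c] := MVT_segment ab (fun x _ => fdf x) cf.
rewrite in_itv /= => /df0 dfc0 fE.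
by rewrite -subr_ge0 fE mulr_ge0 ?subr_ge0.
Qed.

(** The function [g] takes the value -1 at both 0 and 1. By the sign of [dg] it increases up to
    [3 - e], decreases from there to 1 and increases again, so -1 is its minimum on the
    half-line. *)
Lemma expR_ge_tangent_sqr (R : realType) (s : R) :
  0 <= s -> expR 1 * s + (1 - s) ^+ 2 <= expR s.
Proof.
move=> s0; set e := expR 1.
have e2 : 2 <= e := expR_ge1Dx 1.
pose g (x : R) := - ((1 + (e - 2) * x + x * x) * expR (- x)).
pose dg (x : R) := (x - 1) * (x - (3 - e)) * expR (- x).
have gdg (x : R) : is_derive x 1 g (dg x).
  rewrite /g; apply: is_derive_eq; rewrite /dg /GRing.scale /=; ring.
have g0 : g 0 = -1 by rewrite /g oppr0 expR0; ring.
have g1 : g 1 = -1.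
  by rewrite /g expRN -/e; field; rewrite gt_eqF //; lra.
suff : -1 <= g s.
  rewrite /g lerN2 expRN -ler_pdivlMr ?invr_gt0 ?expR_gt0 // invrK mul1r.
  by apply: le_trans; lra.
have dg_ge0 x : 0 <= (x - 1) * (x - (3 - e)) -> 0 <= dg x.
  by move=> ?; rewrite mulr_ge0 ?expR_ge0.
have [s1|/ltW s1] := leP 1 s.
  rewrite -g1; apply: is_derive_homo gdg s1 _ => x /andP[x1 _].
  by apply: dg_ge0; rewrite mulr_ge0 //; lra.
have [s2|/ltW s2] := leP s (3 - e).
  rewrite -g0; apply: is_derive_homo gdg s0 _ => x /andP[x1 x2].
  by apply: dg_ge0; rewrite mulr_le0 //; lra.
rewrite -g1 -lerN2.
have ngdg (x : R) : is_derive x 1 (fun y => - g y) (- dg x).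
  exact: is_deriveN.
apply: is_derive_homo ngdg s1 _ => x /andP[x1 x2].
rewrite oppr_ge0 mulr_le0_ge0 ?expR_ge0 //.
by rewrite mulr_le0_ge0 //; lra.
Qed.

(** With [a = expR s], the difference [a ^ 2 - (e * s) ^ 2] factors as [(a - e * s) * (a + e * s)].
    The first factor is at least [(1 - s) ^ 2], the second at least 1. This is the bound needed on
    the axes. *)
Lemma expR2_ge (R : realType) (s : R) :
  0 <= s -> (1 - s) ^+ 2 + (expR 1 * s) ^+ 2 <= expR (2 * s).
Proof.
move=> s0; have := expR_ge_tangent_sqr s0.
have -> : expR (2 * s) = expR s ^+ 2 by rewrite -expRM_natl.
have := expR_ge1Dx s; have := expR_gt1Dx (oner_neq0 R).
move: (expR s) (expR 1) => a e e2 a1 ae.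
have es0 : 0 <= e * s by rewrite mulr_ge0 //; lra.
have : 0 <= (a - e * s) * (a + e * s - 1).
  by rewrite mulr_ge0 //; have := sqr_ge0 (1 - s); lra.
nra.
Qed.

(** Convexity from the tangent at [w * u], evaluated at 0 and at [u]: with weights [1 - w] and [w]
    the linear terms cancel. *)
Lemma expR_chord (R : realType) (w u : R) :
  0 <= w <= 1 -> expR (w * u) <= (1 - w) + w * expR u.
Proof.
move=> /andP[w0 w1]; set a := expR (w * u).
have a0 : 0 < a := expR_gt0 _.
have h1 : a * (1 - w * u) <= 1.
  rewrite mulrC -ler_pdivlMr // div1r -expRN.
  by apply: le_trans (expR_ge1Dx _); lra.
have h2 : a * (1 + (1 - w) * u) <= expR u.
  have -> : expR u = a * expR ((1 - w) * u) by rewrite -expRD; congr expR; ring.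
  by rewrite ler_pM2l // expR_ge1Dx.
have := ler_wpM2l w0 h2.
have w0' : 0 <= 1 - w by lra.
have := ler_wpM2l w0' h1.
lra.
Qed.

(* The inequality reads [(1 - z) ^ 2 * q + b ^ 2 <= a ^ 2]; with
   [m = 1 + (1 - w) * z] it is the product of [((1 - z) * m) ^ 2 <= a - b] and
   [q <= m ^ 2 * (a + b)]. *)
Lemma diagonal_bound (R : realType) (w z : R) : 0 <= w <= 1 -> 0 <= z ->
  (1 - z) ^+ 2 * ((1 + z - 2 * w * z) ^+ 2 + 2 * (expR 1 * w * z) ^+ 2)
    + expR (2 + 2 * w) * z ^+ 4 <= expR (4 * w * z + 2 * (1 - w) * z ^+ 2).
Proof.
move=> /andP[w0 w1] z0; set e := expR 1.
have e2 : 2 <= e := expR_ge1Dx 1.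
set b := expR (1 + w) * z ^+ 2.
set a := expR (2 * w * z + (1 - w) * z ^+ 2).
set m := 1 + (1 - w) * z.
have wz0 : 0 <= w * z by rewrite mulr_ge0.
have vz0 : 0 <= (1 - w) * z by rewrite mulr_ge0 //; lra.
have b0 : 0 <= b by rewrite mulr_ge0 ?expR_ge0 ?sqr_ge0.
have m1 : 1 <= m by rewrite /m; lra.
have -> : expR (2 + 2 * w) * z ^+ 4 = b ^+ 2.
  by rewrite /b exprMn -expRM_natl -exprM; congr (expR _ * _); ring.
have -> : expR (4 * w * z + 2 * (1 - w) * z ^+ 2) = a ^+ 2.
  by rewrite /a -expRM_natl; congr expR; ring.
have amb : ((1 - z) * m) ^+ 2 <= a - b.
  (* Here [a - b >= expR (w * z) * (expR s - e * s)], so the tangent inequality at [s] gives the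
     square. It is equivalent to the linear bound [chord]. *)
  pose s := w * z + (1 - w) * z ^+ 2.
  have s0 : 0 <= s.
    by rewrite /s addr_ge0 // expr2 mulrA mulr_ge0.
  have -> : (1 - z) * m = 1 - s by rewrite /m /s; ring.
  have -> : a = expR s * expR (w * z).
    by rewrite /a /s -expRD; congr expR; ring.
  have chord : z * expR (w * (1 - z)) <= w + (1 - w) * z.
    have : z * expR (1 - z) <= 1.
      rewrite -ler_pdivlMr ?expR_gt0 // div1r -expRN.
      by apply: le_trans (expR_ge1Dx _); lra.
    move=> /(ler_wpM2l w0).
    have := ler_wpM2l z0 (@expR_chord _ w (1 - z) _).
    by rewrite w0 w1 => /(_ isT); lra.
  have : b <= e * s * expR (w * z).
    have -> : b = z * (e * expR (w * z)) * (z * expR (w * (1 - z))).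
      rewrite /b /e.
      have -> : 1 + w = 1 + w * z + w * (1 - z) by ring.
      by rewrite !expRD; ring.
    have -> : e * s * expR (w * z)
        = z * (e * expR (w * z)) * (w + (1 - w) * z) by rewrite /s; ring.
    rewrite ler_wpM2l // !mulr_ge0 ?expR_ge0 //.
  have := ler_wpM2r (expR_ge0 (w * z)) (expR_ge_tangent_sqr s0).
  have : 1 <= expR (w * z) by apply: le_trans (expR_ge1Dx _); lra.
  have := sqr_ge0 (1 - s); rewrite -/e.
  move: (expR s) (expR (w * z)) ((1 - s) ^+ 2) => A B C; nra.
have apb : (1 + z - 2 * w * z) ^+ 2 + 2 * (e * w * z) ^+ 2 <= m ^+ 2 * (a + b).
  have ge1 : 1 <= a + b.
    apply: le_trans (_ : a <= _); last by lra.
    apply: le_trans (expR_ge1Dx _).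
    by rewrite expr2 mulrA -mulrA; have := mulr_ge0 vz0 z0; lra.
  have gew : (1 - w * z) ^+ 2 + 2 * (e * (w * z)) ^+ 2 <= a + b.
    have h1 : (1 - w * z) ^+ 2 + (e * (w * z)) ^+ 2 <= a.
      apply: le_trans (expR2_ge wz0) _; rewrite ler_expR.
      by rewrite expr2 [_ * (z * z)]mulrA; have := mulr_ge0 vz0 z0; lra.
    have h2 : (e * (w * z)) ^+ 2 <= b.
      have -> : (e * (w * z)) ^+ 2 = (e * w) ^+ 2 * z ^+ 2 by ring.
      rewrite /b ler_wpM2r ?sqr_ge0 //.
      (* The tangent at 0 gives [expR (w - 1) >= w], and [w >= w ^ 2] on the unit interval. *)
      have -> : expR (1 + w) = e ^+ 2 * expR (w - 1).
        by rewrite /e -expRM_natl -expRD; congr expR; ring.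
      rewrite exprMn ler_wpM2l ?sqr_ge0 //.
      have := expR_ge1Dx (w - 1); nra.
    lra.
  (* [q / m ^ 2] is a convex quadratic in [v = w * z / m], between [0] and
     [w * z]. *)
  move: (a + b) ge1 gew => S ge1 gew.
  have m1S : 0 <= (m - 1) ^+ 2 * (S - 1).
    by rewrite mulr_ge0 ?sqr_ge0 //; lra.
  have m1gew : (m - 1) * ((1 - w * z) ^+ 2 + 2 * (e * (w * z)) ^+ 2)
      <= (m - 1) * S by apply: ler_wpM2l => //; lra.
  have mz : 1 + z - 2 * w * z = m - w * z by rewrite /m; ring.
  have ewz : e * w * z = e * (w * z) by ring.
  rewrite mz ewz.
  have h0 : 0 <= (e * (w * z)) ^+ 2 by rewrite sqr_ge0.
  move: h0 gew m1gew; move: ((e * (w * z)) ^+ 2) (w * z) => E v h0 gew m1gew.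
  have := mulr_ge0 (_ : 0 <= m - 1) h0; rewrite subr_ge0 => /(_ m1).
  have : 0 <= (m - 1) * v ^+ 2 by rewrite mulr_ge0 ?sqr_ge0 //; lra.
  nra.
have := ler_wpM2l (sqr_ge0 (1 - z)) apb.
have : 0 <= a + b by rewrite addr_ge0 ?expR_ge0.
move/ler_wpM2r => /(_ _ _ amb).
lra.
Qed.

Lemma quadratic_le_endpoints (R : realFieldType) (a b c q m d : R) :
  0 <= a -> 0 <= q <= m -> c <= d -> a * m ^+ 2 + b * m + c <= d ->
  a * q ^+ 2 + b * q + c <= d.
Proof.
move=> a0 /andP[q0 qm] cd md.
have [m0|m0] := leP m 0.
  have -> : q = 0 by lra.
  by rewrite expr0n mulr0 mulr0 !add0r.
(* Convexity as an identity: [m] times the value at [q] is [q] times the value at [m], plus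
   [(m - q) * c], minus [a * m * q * (m - q)]. *)
rewrite -(ler_pM2l m0).
have h1 := ler_wpM2l q0 md.
have h2 : (m - q) * c <= (m - q) * d by rewrite ler_wpM2l //; lra.
have : 0 <= a * (m * (q * (m - q))) by rewrite !mulr_ge0 //; lra.
lra.
Qed.

(* Along a level line [w * (X + Y) + (1 - w) * X * Y = c] of the intensity the
   left-hand side is a convex quadratic in [X * Y], hence it is largest on the
   boundary ([X * Y = 0]) or on the diagonal. *)
Lemma quadrant_bound (R : realType) (w X Y : R) :
  0 < w <= 1 -> 0 <= X -> 0 <= Y ->
  (1 - w * (X + Y) + (2 * w - 1) * (X * Y)) ^+ 2
    + expR 1 ^+ 2 * ((w * X * (1 - Y)) ^+ 2 + (w * Y * (1 - X)) ^+ 2)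
    + expR (2 + 2 * w) * (X * Y) ^+ 2
  <= expR (2 * w * (X + Y) + 2 * (1 - w) * (X * Y)).
Proof.
move=> /andP[w0 w1] X0 Y0; have w1' : 0 <= 1 - w by lra.
have q0 : 0 <= X * Y by rewrite mulr_ge0.
set c := w * (X + Y) + (1 - w) * (X * Y).
have c0 : 0 <= c.
  by apply: addr_ge0; apply: mulr_ge0 => //; [exact: ltW|exact: addr_ge0].
(* The point [(z, z)] is where the level line meets the diagonal. The root is taken in rationalised
   form [c / (w + s)], which stays valid when [w = 1] and the equation is linear. *)
have [z z0 zc] : exists2 z, 0 <= z & 2 * w * z + (1 - w) * z ^+ 2 = c.
  have d0 : 0 <= w ^+ 2 + (1 - w) * c by rewrite addr_ge0 ?sqr_ge0 ?mulr_ge0.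
  have := sqr_sqrtr d0; have := sqrtr_ge0 (w ^+ 2 + (1 - w) * c).
  move: (Num.sqrt _) => s s0 sE.
  have ws : 0 < w + s by lra.
  exists (c / (w + s)); first by rewrite divr_ge0 // ltW.
  apply: (@mulIf _ ((w + s) ^+ 2)); first by rewrite expf_neq0 // gt_eqF.
  transitivity (c * (2 * w * (w + s) + (1 - w) * c)).
    by field; rewrite gt_eqF.
  have -> : (1 - w) * c = s ^+ 2 - w ^+ 2 by lra.
  ring.
(* If [X * Y > z ^ 2], then [X + Y > 2 * z] by AM-GM, and the level at [(X, Y)] would exceed [c]. *)
have qz : X * Y <= z ^+ 2.
  rewrite leNgt; apply/negP => qz.
  have : 2 * z < X + Y.
    rewrite ltNge; apply/negP => XYz.
    have : (X + Y) ^+ 2 <= (2 * z) ^+ 2 by rewrite lerXn2r // nnegrE; lra.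
    have := sqr_ge0 (X - Y); lra.
  rewrite -(ltr_pM2l w0); have := ler_wpM2l w1' (ltW qz).
  rewrite /c in zc; lra.
have -> : 2 * w * (X + Y) + 2 * (1 - w) * (X * Y) = 2 * c by rewrite /c; ring.
set e := expR 1; set E := expR (2 + 2 * w).
(* Coefficients in [X * Y] after eliminating [X + Y] by [w * (X + Y) = c - (1 - w) * X * Y]. *)
pose A := w ^+ 2 + e ^+ 2 * (1 + w ^+ 2) + E.
pose B := 2 * w * (1 - c) - 2 * e ^+ 2 * (c + w ^+ 2).
pose C := (1 - c) ^+ 2 + (e * c) ^+ 2.
rewrite [leLHS](_ : _ = A * (X * Y) ^+ 2 + B * (X * Y) + C); last first.
  by rewrite /A /B /C /c; ring.
apply: (@quadratic_le_endpoints _ _ _ _ _ (z ^+ 2)).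
- have h : 0 <= 1 + w ^+ 2 by rewrite addr_ge0 ?sqr_ge0.
  have := mulr_ge0 (sqr_ge0 e) h; have := sqr_ge0 w.
  by have := expR_ge0 (2 + 2 * w); rewrite /A /E; lra.
- by rewrite q0.
- exact: expR2_ge.
have := @diagonal_bound _ w z; rewrite w1 ltW // => /(_ isT z0).
have -> : 4 * w * z + 2 * (1 - w) * z ^+ 2 = 2 * c by rewrite -zc; ring.
apply: le_trans; rewrite le_eqVlt; apply/orP; left; apply/eqP.
by rewrite /A /B /C -zc -/e -/E; ring.
Qed.

(** * Positive semidefinite matrices, Hadamard's inequality and Gram determinants *)

Definition psdmx (R : numDomainType) n (A : 'M[R]_n) :=
  A^T = A /\ forall u : 'rV_n, 0 <= (u *m A *m u^T) 0 0.

Lemma psdmx_diag_ge0 (R : numDomainType) n (A : 'M[R]_n) i :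
  psdmx A -> 0 <= A i i.
Proof.
by move=> [_ /(_ (delta_mx 0 i))]; rewrite -rowE trmx_delta -colE !mxE.
Qed.

Lemma psdmx_block_form (R : comNzRingType) n (a : 'M[R]_1) (b : 'rV_n) (C : 'M_n)
    (x : R) (u : 'rV_n) :
  (row_mx x%:M u *m block_mx a b b^T C *m (row_mx x%:M u)^T) 0 0
  = x ^+ 2 * a 0 0 + x * (b *m u^T) 0 0 *+ 2 + (u *m C *m u^T) 0 0.
Proof.
rewrite mul_row_block tr_row_mx mul_row_col !mulmxDl tr_scalar_mx.
have -> : u *m b^T = (b *m u^T)^T by rewrite trmx_mul trmxK.
rewrite !mul_scalar_mx !mul_mx_scalar -scalemxAl.
move: (u *m C *m u^T) (b *m u^T) => y z.
by rewrite !mxE; ring.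
Qed.

(** The form of the Schur complement at [u] is the full form at [(x, u)], with [x] the minimising
    first coordinate [- (b u^T) / a]. *)
Lemma psdmx_schur (R : realFieldType) n (a : 'M[R]_1) (b : 'rV_n) (C : 'M_n) :
  0 < a 0 0 -> psdmx (block_mx a b b^T C) ->
  psdmx (C - (a 0 0)^-1 *: (b^T *m b)).
Proof.
move=> a0 [sA pA]; split.
  move: sA; rewrite tr_block_mx => /eq_block_mx[_ _ _ sC].
  by rewrite linearB linearZ /= trmx_mul trmxK sC.
move=> u; pose y := (b *m u^T) 0 0.
have := pA (row_mx (- (y / a 0 0))%:M u); rewrite psdmx_block_form -/y.
rewrite mulmxBr mulmxBl -scalemxAr -scalemxAl mulmxA -(mulmxA (u *m b^T)).
have -> : u *m b^T = (b *m u^T)^T by rewrite trmx_mul trmxK.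
rewrite [b *m u^T]mx11_scalar -/y tr_scalar_mx !mxE /= big_ord1 !mxE eqxx !mulr1n.
move: (\sum_j _) => z; rewrite (_ : _ + _ + z = z - (a 0 0)^-1 * (y * y)) //.
by field; rewrite gt_eqF.
Qed.

Lemma psdmx_row0 (R : realFieldType) n (a : 'M[R]_1) (b : 'rV_n) (C : 'M_n) :
  a 0 0 = 0 -> psdmx (block_mx a b b^T C) -> b = 0.
Proof.
move=> a0 [_ pA]; apply/rowP => j; rewrite mxE; apply/eqP/negPn/negP => bj.
(* The form at [(x, e_j)] is [2 * x * b_j + C_jj]; this [x] makes it -1. *)
have := pA (row_mx (- (C j j + 1) / (2 * b 0 j))%:M (delta_mx 0 j)).
rewrite psdmx_block_form a0 trmx_delta -rowE -!colE !mxE.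
rewrite leNgt => /negP; apply.
suff -> : - (C j j + 1) / (2 * b 0 j) * b 0 j *+ 2 = - (C j j + 1) by lra.
by field.
Qed.

(** Induction by elimination of the first row: the determinant is the pivot times that of the Schur
    complement, whose diagonal is at most that of [C]. A zero pivot makes both sides 0. *)
Lemma psdmx_hadamard (R : realFieldType) n (A : 'M[R]_n) :
  psdmx A -> \det A <= \prod_i A i i.
Proof.
elim: n A => [|n IHn] A pA; first by rewrite det_mx00 big_ord0.
move: A pA; rewrite -[n.+1]/(1 + n)%N => A.
rewrite -[A]submxK; move: (ulsubmx A) (ursubmx A) (dlsubmx A) (drsubmx A).
move=> a b b' C pA.
have bE : b' = b^T.
  by case: (pA); rewrite tr_block_mx => /eq_block_mx[].
move: pA; rewrite {}bE => pA.
rewrite big_split_ord /= big_ord1 block_mxEul.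
under eq_bigr => i _ do rewrite block_mxEdr.
have := psdmx_diag_ge0 (lshift n 0) pA; rewrite block_mxEul.
rewrite le_eqVlt => /orP[/eqP a0|a0].
  rewrite -a0 mul0r (psdmx_row0 (esym a0) pA) trmx0 det_ublock.
  by rewrite det_mx11 -a0 mul0r.
have -> : block_mx a b b^T C = block_mx 1%:M 0 ((a 0 0)^-1 *: b^T) 1%:M
    *m block_mx a b 0 (C - (a 0 0)^-1 *: (b^T *m b)).
  rewrite mulmx_block !mul1mx !mul0mx !addr0 -!scalemxAl addrC subrK.
  rewrite [X in _ *m X]mx11_scalar mul_mx_scalar scalerA mulVf ?scale1r //.
  by rewrite gt_eqF.
rewrite det_mulmx det_lblock !det1 !mul1r det_ublock det_mx11 ler_pM2l //.
have pS := psdmx_schur a0 pA.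
apply: le_trans (IHn _ pS) _; apply: ler_prod => i _.
rewrite (psdmx_diag_ge0 i pS) /= !mxE big_ord1 !mxE gerBl.
by rewrite mulr_ge0 ?invr_ge0 ?(ltW a0) // -expr2 sqr_ge0.
Qed.

Lemma gram_entry (R : comNzRingType) m n (L : 'M[R]_(m, n)) (v : 'rV_m) a b :
  (L^T *m diag_mx v *m L) a b = \sum_i v 0 i * L i a * L i b.
Proof.
rewrite mul_mx_diag mxE; apply: eq_bigr => i _.
by rewrite !mxE [L i a * _]mulrC.
Qed.

Lemma gram_psdmx (R : realDomainType) m n (L : 'M[R]_(m, n)) (v : 'rV_m) :
  (forall i, 0 <= v 0 i) -> psdmx (L^T *m diag_mx v *m L).
Proof.
move=> v0; split=> [|u]; first by rewrite !trmx_mul trmxK tr_diag_mx mulmxA.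
rewrite (_ : u *m _ *m _ = (L *m u^T)^T *m diag_mx v *m (L *m u^T)).
  rewrite gram_entry sumr_ge0 // => i _.
  by rewrite -mulrA -expr2 mulr_ge0 ?sqr_ge0.
by rewrite trmx_mul trmxK !mulmxA.
Qed.

Lemma det_gram_le (R : realFieldType) m n (L : 'M[R]_(m, n)) (v : 'rV_m)
    (l : 'I_n -> R) :
  (forall i, 0 <= v 0 i) -> (forall b, 0 < l b) ->
  \sum_i v 0 i * \sum_b L i b ^+ 2 / l b <= 1 ->
  \det (L^T *m diag_mx v *m L) <= n%:R ^- n * \prod_b l b.
Proof.
move=> v0 l0 trace_le1; have pN := gram_psdmx L v0.
set N := _ *m L in pN *.
pose E b := N b b / l b.
have E0 b : 0 <= E b by rewrite divr_ge0 ?psdmx_diag_ge0 // ltW.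
apply: le_trans (psdmx_hadamard pN) _.
have -> : \prod_b N b b = \prod_b E b * \prod_b l b.
  by rewrite -big_split; apply: eq_bigr => b _; rewrite /E /= mulfVK // gt_eqF.
rewrite ler_wpM2r ?prodr_ge0 //; first by move=> b _; exact: ltW.
have [+ _] := leif_AGM (A := 'I_n) (E := E) (fun b _ => E0 b).
rewrite card_ord => /le_trans; apply.
rewrite -exprVn lerXn2r ?nnegrE ?invr_ge0 ?divr_ge0 ?sumr_ge0 //.
rewrite ler_piMl ?invr_ge0 //; apply: le_trans trace_le1.
(* The sum of the [E b] is the trace hypothesis with the order of summation exchanged. *)
rewrite le_eqVlt; apply/orP; left; apply/eqP.
under [RHS]eq_bigr => i _ do rewrite mulr_sumr.
rewrite exchange_big; apply: eq_bigr => b _.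
by rewrite /E /N gram_entry mulr_suml; apply: eq_bigr => i _; ring.
Qed.

(** * Saturated designs and the support points of the model *)

Section Model.
Variables (R : realType) (k : nat).

Definition featmx m (pts : 'I_m -> 'rV[R]_k) : 'M[R]_(m, #|fidx k|) :=
  \matrix_(i, a) feat (pts i) (enum_val a).

Lemma infmat_gram (beta : fidx k -> R) (xi : design R k) :
  let P := featmx (@dpts R k xi) in
  infmat beta xi
  = P^T *m diag_mx (\row_i (dw i * lam beta (@dpts R k xi i))) *m P.
Proof.
by apply/matrixP => a b; rewrite gram_entry mxE; apply: eq_bigr => i _; rewrite !mxE.
Qed.

Lemma sum_enum_val (f : fidx k -> R) :
  \sum_(b < #|fidx k|) f (enum_val b) = \sum_b f b.
Proof. by rewrite -(big_enum_val (A := fidx k)). Qed.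

(* The Kiefer-Wolfowitz condition for a saturated design. *)
Lemma saturated_D_optimal (beta : fidx k -> R) (X : 'rV[R]_k -> Prop)
    (s : fidx k -> 'rV[R]_k) (w : R) :
  let xi := @Design R k #|fidx k| (fun i => s (enum_val i)) (fun=> w) in
  w = #|fidx k|%:R^-1 -> design_on X xi ->
  (forall x, X x -> exists L : fidx k -> R,
     (forall a, feat x a = \sum_b L b * feat (s b) a) /\
     lam beta x * \sum_b L b ^+ 2 / lam beta (s b) <= 1) ->
  locally_D_optimal beta X xi.
Proof.
move=> xi wE xiX interp; split=> // -[m pts v] [_ [ptsX [v0 v1]]].
have [L LE] := boolp.choice (fun i => interp _ (ptsX i)).
pose F := featmx (fun b : 'I_#|fidx k| => s (enum_val b)).
pose G : 'M[R]_(m, #|fidx k|) := \matrix_(i, b) L i (enum_val b).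
have FE : featmx pts = G *m F.
  apply/matrixP => i a; rewrite !mxE (LE i).1.
  rewrite -(@sum_enum_val (fun b => L i b * feat (s b) (enum_val a))).
  by apply: eq_bigr => b _; rewrite !mxE.
rewrite !infmat_gram /= FE -/F.
set v' := \row_i _.
have -> : (G *m F)^T *m diag_mx v' *m (G *m F)
    = F^T *m (G^T *m diag_mx v' *m G) *m F by rewrite trmx_mul !mulmxA.
rewrite 2!det_mulmx [leRHS]det_mulmx det_mulmx det_tr det_diag.
(* Both sides carry the nonnegative factor [\det F ^ 2]; what remains compares the determinant of
   the middle Gram matrix with the product of [w * lam] over the support. *)
rewrite ![\det F * _]mulrC -!mulrA ler_wpM2r // -?expr2 ?sqr_ge0 //.
under eq_bigr => b _ do rewrite mxE.
rewrite big_split /= prodr_const card_ord wE exprVn.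
have lam_gt0 x : 0 < lam beta x := expR_gt0 _.
apply: det_gram_le => [i|//|]; first by rewrite mxE mulr_ge0 // ltW.
rewrite -v1; apply: ler_sum => i _; rewrite mxE -[leRHS]mulr1 -mulrA ler_wpM2l //.
have := (LE i).2; congr (_ * _ <= _).
rewrite -(@sum_enum_val (fun b => L i b ^+ 2 / lam beta (s b))).
by apply: eq_bigr => b _; rewrite mxE.
Qed.

(** Pairs are counted by their larger index [j], which leaves [j] choices for the smaller one; the
    sum of these is the binomial coefficient ['C(k, 2)]. *)
Lemma card_fidx : #|fidx k| = (1 + k + (k * (k - 1)) %/ 2)%N.
Proof.
rewrite card_option card_sum card_ord card_sig add1n addSn; congr (_ + _).+1.
rewrite subn1 divn2 -bin2 -bin2_sum big_mkord.
rewrite -sum1_card (eq_bigl (fun p : 'I_k * 'I_k => (p.1 < p.2)%N)) //.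
rewrite -(pair_big_dep predT (fun i j : 'I_k => (i < j)%N) (fun _ _ => 1%N)) /=.
rewrite (exchange_big_dep predT) //=; apply: eq_bigr => j _.
rewrite sum1_card -[RHS](card_ord j).
rewrite -[in RHS](card_image (f := widen_ord (ltnW (ltn_ord j)))); last first.
  by move=> a b /(congr1 val) /= ab; apply: val_inj.
apply: eq_card => i; transitivity (i < j)%N; first by [].
symmetry.
apply/fintype.imageP/idP => [[i' _ ->]|ij]; first exact: (ltn_ord i').
by exists (Ordinal ij) => //; apply: val_inj.
Qed.

(** The value is the positive root of [r * t ^ 2 + t = 2]. By this equation the intensity at the
    point of a pair is [expR (- (2 + t))]. *)
Lemma tval_spec (r : R) : 0 <= r ->
  0 < Defs.tval r <= 2 /\ r * Defs.tval r ^+ 2 + Defs.tval r = 2.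
Proof.
rewrite /Defs.tval => r0; case: ifPn => [r1|]; last first.
  rewrite -leNgt => r1; have -> : r = 0 by lra.
  by split; lra.
have d0 : 0 <= 1 + 8 * r by lra.
have := sqr_sqrtr d0; have := sqrtr_ge0 (1 + 8 * r).
move: (Num.sqrt _) => s s0 sE.
have s1 : 1 < s by rewrite ltNge; apply/negP => s1; nra.
have e : r * ((s - 1) / (2 * r)) ^+ 2 + (s - 1) / (2 * r) = 2.
  have -> : r * ((s - 1) / (2 * r)) ^+ 2 + (s - 1) / (2 * r)
    = (s ^+ 2 - 1) / (4 * r) by field; rewrite gt_eqF.
  by rewrite sE; field; rewrite gt_eqF.
split=> //; rewrite divr_gt0 /=; [|lra..].
by have := mulr_ge0 r0 (sqr_ge0 ((s - 1) / (2 * r))); lra.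
Qed.

Variable rho : pairs k -> R.
Hypothesis rho_ge0 : forall p, 0 <= rho p.

Let t p := Defs.tval (rho p).

Lemma tval_rho_neq0 p : t p != 0.
Proof. by have [/andP[t0 _] _] := tval_spec (rho_ge0 p); rewrite gt_eqF. Qed.

Lemma pairs_neq (p : pairs k) : (val p).1 != (val p).2.
Proof. by rewrite -val_eqE ltn_eqF //; exact: valP p. Qed.

Lemma feat_supp_pair b q :
  feat (supp rho b) (Some (inr q)) = if b == Some (inr q) then t q ^+ 2 else 0.
Proof.
case: b => [[i|p]|] /=; rewrite !mxE ?mulr0 //.
  have := pairs_neq q; case: (eqVneq (val q).1 i) => [->|_ _]; last by rewrite mul0r.
  by rewrite eq_sym => /negbTE ->; rewrite mulr0.
rewrite -[Some _ == _]/(p == q).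
have [<-|pq] := eqVneq p q; first by rewrite !eqxx orbT.
case: ifPn => [h1|]; last by rewrite mul0r.
case: ifPn => [h2|]; last by rewrite mulr0.
case/eqP: pq; apply: val_inj.
(* Both indices of [q] lie in [p]; since each pair is increasing, only the matching in order
   survives. *)
case: p q h1 h2 => [[a b] /= ab] [[c d] /= cd] h1 h2.
move: h1 h2 ab cd => /orP[]/eqP-> /orP[]/eqP-> //; rewrite ?ltnn // => h1 h2.
by have := ltn_trans h1 h2; rewrite ltnn.
Qed.

(** A pair point is recognised by its nonzero interaction feature, an axis point by its coordinate
    2. *)
Lemma supp_inj : injective (supp rho).
Proof.
have pairP b q : supp rho b = supp rho (Some (inr q)) -> b = Some (inr q).
  move=> e; have := feat_supp_pair b q; rewrite e feat_supp_pair eqxx.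
  case: eqP => // _ /eqP; rewrite expf_eq0 /=.
  by have := tval_rho_neq0 q; rewrite /t => /negbTE ->.
have coordP b i : supp rho b = supp rho (Some (inl i)) -> b = Some (inl i).
  case: b => [[j|q]|] e; last first.
  - by move/rowP: e => /(_ i) /esym /eqP; rewrite !mxE eqxx pnatr_eq0.
  - by rewrite (pairP _ _ (esym e)).
  move/rowP: e => /(_ i); rewrite !mxE eqxx.
  by case: eqP => [->//|_ /esym /eqP]; rewrite pnatr_eq0.
move=> [[i|p]|] [[j|q]|] // e.
- exact: coordP.
- exact: pairP.
- exact/esym/coordP/esym.
- exact: coordP.
- exact: pairP.
- exact/esym/pairP/esym.
- exact: coordP.
- exact: pairP.
Qed.

Lemma supp_region b : (2 <= k)%N -> region (supp rho b).
Proof.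
move=> k2.
have coord (i j : 'I_k) (c : R) : 0 <= c -> i != j ->
    region (\row_l (if l == i then c else 0)).
  move=> c0; rewrite -val_eqE neq_ltn => /orP[] ij; [exists i, j|exists j, i];
    split=> //; rewrite !mxE; do !split; rewrite ?eqxx //; try by case: ifP.
  - by move=> l li _; rewrite mxE (negbTE li).
  - by move=> l _ li; rewrite mxE (negbTE li).
have other (i : 'I_k) : exists j : 'I_k, i != j.
  pose i0 := Ordinal (leq_trans (isT : (0 < 2)%N) k2); pose i1 := Ordinal k2.
  have [->|] := eqVneq i i0; first by exists i1.
  by exists i0.
case: b => [[i|p]|].
- by have [j ij] := other i; apply: coord ij; lra.
- exists (val p).1, (val p).2; split; first exact: valP p.
  have [/andP[/ltW t0 _] _] := tval_spec (rho_ge0 p).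
  rewrite !mxE !eqxx orbT; split=> //; split=> // l l1 l2.
  by rewrite mxE (negbTE l1) (negbTE l2).
pose i0 := Ordinal (leq_trans (isT : (0 < 2)%N) k2).
have [j ij] := other i0; have := coord _ _ 0 (lexx _) ij.
by congr region; apply/rowP => l; rewrite !mxE; case: ifP.
Qed.

(** * Interpolation on one quadrant *)

Section Quadrant.
Variable p : pairs k.
Let i := (val p).1.
Let j := (val p).2.

Definition in_quadrant (x : 'rV[R]_k) :=
  forall l : 'I_k, l != i -> l != j -> x ord0 l = 0.

Lemma sum_quadrant (g : fidx k -> R) :
  (forall l, l != i -> l != j -> g (Some (inl l)) = 0) ->
  (forall q, q != p -> g (Some (inr q)) = 0) ->
  \sum_b g b
  = g None + g (Some (inl i)) + g (Some (inl j)) + g (Some (inr p)).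
Proof.
move=> gl gq; have ij := pairs_neq p.
rewrite (bigD1 None) //= (bigD1 (Some (inl i))) //=.
rewrite (bigD1 (Some (inl j))); last first.
  by rewrite /= (inj_eq Some_inj) (inj_eq inl_inj) eq_sym.
rewrite (bigD1 (Some (inr p))) //= big1 => [|b]; first by rewrite addr0 !addrA.
case: b => [[l|q]|] //= => [/andP[/andP[li lj] _]|qp]; first exact: (gl l li lj).
exact: (gq q qp).
Qed.

(** The support point of [p] acts as an indicator of [{i, j}]: its product over [q] vanishes
    although [t p] is nonzero, so one index of [q] lies outside, where [x] is 0 too. *)
Lemma feat_quadrant0 x q :
  in_quadrant x -> q != p -> feat x (Some (inr q)) = 0.
Proof.
move=> xq qp; have := feat_supp_pair (Some (inr p)) q.
rewrite -[Some _ == _]/(p == q) eq_sym (negbTE qp) => /eqP.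
rewrite /= !mxE mulf_eq0 => /orP[].
  case: ifPn => [_|]; first by rewrite (negbTE (tval_rho_neq0 p)).
  by rewrite negb_or => /andP[? ?] _; rewrite xq ?mul0r.
case: ifPn => [_|]; first by rewrite (negbTE (tval_rho_neq0 p)).
by rewrite negb_or => /andP[? ?] _; rewrite [x _ (val q).2]xq ?mulr0.
Qed.

Lemma lam_quadrant x : in_quadrant x ->
  lam (beta_of rho) x
  = expR (- (x ord0 i + x ord0 j + rho p * (x ord0 i * x ord0 j))).
Proof.
move=> xq; rewrite /lam sum_quadrant => [|l li lj|q qp].
- by congr expR; rewrite /= -/i -/j; ring.
- by rewrite /= xq ?mul0r.
- by rewrite feat_quadrant0 ?mul0r.
Qed.

Lemma quadrant_interpolation x :
  in_quadrant x -> 0 <= x ord0 i -> 0 <= x ord0 j ->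
  exists L : fidx k -> R,
    (forall a, feat x a = \sum_b L b * feat (supp rho b) a) /\
    lam (beta_of rho) x * \sum_b L b ^+ 2 / lam (beta_of rho) (supp rho b) <= 1.
Proof.
move=> xq xi0 xj0; have ij := pairs_neq p; rewrite -/i -/j in ij.
have [/andP[t0 t2] tE] := tval_spec (rho_ge0 p); rewrite -/(t p) in t0 t2 tE.
have tN0 := tval_rho_neq0 p.
set u := t p in t0 t2 tE tN0.
(* In units of [u] the pair point is [(1, 1)] and the axis points are at distance [1 / w]. [L]
   solves the four interpolation equations for 1, [x_i], [x_j] and [x_i * x_j]; its value at the
   origin makes the weights sum to 1. *)
pose w := u / 2; pose X := x ord0 i / u; pose Y := x ord0 j / u.
pose L (b : fidx k) : R :=
  match b with
  | None => 1 - w * (X + Y) + (2 * w - 1) * (X * Y)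
  | Some (inl l) => if l == i then w * X * (1 - Y)
                    else if l == j then w * Y * (1 - X) else 0
  | Some (inr q) => if q == p then X * Y else 0
  end.
have L0 l : l != i -> l != j -> L (Some (inl l)) = 0.
  by move=> /negbTE /= -> /negbTE ->.
have Lq q : q != p -> L (Some (inr q)) = 0 by move=> /negbTE /= ->.
exists L; split.
  move=> a; rewrite sum_quadrant; first last.
  - by move=> q /Lq ->; rewrite mul0r.
  - by move=> l li lj; rewrite L0 // mul0r.
  case: a => [[l|q]|].
  - rewrite /= !mxE !eqxx [j == i]eq_sym (negbTE ij) -/i -/j -/(t p) -/u.
    have [->|li] := eqVneq l i.
      by rewrite (negbTE ij) /= /X /Y /w; field.
    have [->|lj] := eqVneq l j; first by rewrite /= /X /Y /w; field.
    by rewrite xq //=; ring.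
  - rewrite !feat_supp_pair /= -[Some _ == _]/(p == q) [p == q]eq_sym eqxx.
    have [->|qp] := eqVneq q p; last first.
      by have /= -> := feat_quadrant0 xq qp; ring.
    by rewrite !eqxx -/i -/j -/u /X /Y; field.
  by rewrite /= !eqxx [j == i]eq_sym (negbTE ij) /w; field.
have suppq b : b \in [:: None; Some (inl i); Some (inl j); Some (inr p)] ->
    in_quadrant (supp rho b).
  rewrite !inE => /or4P[]/eqP-> l /negbTE li /negbTE lj; rewrite !mxE //.
  - by rewrite li.
  - by rewrite lj.
  by rewrite -/i -/j li lj.
rewrite sum_quadrant; first last.
- by move=> q /Lq ->; rewrite expr0n mul0r.
- by move=> l li lj; rewrite L0 // expr0n mul0r.
have lam_supp b bs := lam_quadrant (suppq b bs).
rewrite (lam_quadrant xq) !lam_supp ?inE ?eqxx ?orbT //.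
rewrite !expRN !invrK mulrC ler_pdivrMr ?expR_gt0 // mul1r.
rewrite /supp !mxE !eqxx [j == i]eq_sym (negbTE ij) orbT -/(t p) -/u.
have := @quadrant_bound R w X Y.
rewrite !divr_ge0 ?(ltW t0) //.
have -> : 0 < w <= 1 by apply/andP; rewrite /w; split; lra.
move=> /(_ isT isT isT).
(* The right-hand side of [quadrant_bound] is the reciprocal intensity at [x], because the equation
   for [u] gives [rho p * u ^ 2 = 2 - u]. *)
have -> : 2 * w * (X + Y) + 2 * (1 - w) * (X * Y)
    = x ord0 i + x ord0 j + rho p * (x ord0 i * x ord0 j).
  have rE : rho p = (2 - u) / u ^+ 2.
    by apply: (@mulIf _ (u ^+ 2)); rewrite ?expf_neq0 // mulfVK ?expf_neq0 //; lra.
  by rewrite rE /w /X /Y; field.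
apply: le_trans; rewrite le_eqVlt; apply/orP; left; apply/eqP.
rewrite /= !eqxx [j == i]eq_sym (negbTE ij).
(* The reciprocal intensities at the support points are 1 at the origin, [expR 2] on the axes and
   [expR (2 + 2 * w)] at the pair point. *)
have -> : u + u + rho p * (u * u) = 2 + 2 * w by rewrite /w; lra.
rewrite -expRM_natl mulr1 !(addr0, add0r, mulr0, mul0r) expR0 mulr1.
ring.
Qed.

End Quadrant.
End Model.

Theorem theorem7 (R : realType) (k : nat) (hk : (3 <= k)%N)
  (rho : pairs k -> R) (hrho : forall p, 0 <= rho p) :
  locally_D_optimal (beta_of rho) (@region R k) (equal_design rho).
Proof.
apply: saturated_D_optimal; rewrite ?card_fidx //.
  split; first by move=> a b /supp_inj -/(_ hrho) /enum_val_inj.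
  split; first by move=> b; apply: supp_region => //; exact: ltnW.
  split; first by move=> b; rewrite invr_ge0.
  rewrite /= sumr_const card_ord card_fidx -[X in X *+ _]mul1r -mulrnAl mulfV //.
  by rewrite pnatr_eq0.
move=> x [i [j [ij [xi0 [xj0 xq]]]]].
exact: (@quadrant_interpolation _ _ rho hrho (exist _ (i, j) ij)).
Qed.
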